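(* We have $\#\overline{T}(\alpha)=\infty$ for almost all $\alpha\in(0,2/3)$.
   Context: ''Almost all'' is with respect to the $1$-dimensional Lebesgue measure. $\mathbb{N}$ is the set of positive integers; $\lceil x\rceil$ is the least integer greater than or equal to $x$. For a set $X$ of integers, $T(X)$ is the set of all tuples $(k,\ell,m)\in\mathbb{N}^3$ with $k\leq \ell\leq m$ such that all of $k,\ \ell,\ m,\ k+\ell,\ \ell+m,\ m+k,\ k+\ell+m$ belong to $X$. Let $\overline{S}(\alpha)=\{\lceil\alpha n^2\rceil : n\in\mathbb{N}\}$ and $\overline{T}(\alpha)=T(\overline{S}(\alpha))$. *)

(* Defs.v *)
From mathcomp Require Import all_boot all_order all_algebra.
From mathcomp Require Import all_classical all_reals all_analysis.

Set Implicit Arguments.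
Unset Strict Implicit.
Unset Printing Implicit Defensive.

Import Order.TTheory GRing.Theory Num.Theory.

Local Open Scope classical_set_scope.
Local Open Scope ring_scope.

(* The positive integers k <= l <= m are natural numbers, injected into [int]
   to be tested for membership in [X]. *)
Definition sum_triples (X : set int) : set (nat * nat * nat) :=
  [set t | let: (k, l, m) := t in
    [/\ (0 < k)%N, (k <= l)%N & (l <= m)%N] /\
    [/\ X k%:Z, X l%:Z & X m%:Z] /\
    [/\ X (k + l)%N%:Z, X (l + m)%N%:Z & X (m + k)%N%:Z] /\
    X (k + l + m)%N%:Z].

Definition ceil_squares (R : realType) (alpha : R) : set int :=
  [set Num.ceil (alpha * n%:R ^+ 2) | n in [set n : nat | (0 < n)%N]].

Definition ceil_triples (R : realType) (alpha : R) : set (nat * nat * nat) :=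
  sum_triples (ceil_squares alpha).

(* Main.v *)
Require Import Defs.
From mathcomp Require Import all_boot all_order all_algebra.
From mathcomp Require Import all_classical all_reals all_analysis.
From mathcomp Require Import measurable_realfun zify ring lra.

Import Order.TTheory GRing.Theory Num.Theory.
Import numFieldNormedType.Exports.

Local Open Scope classical_set_scope.
Local Open Scope ring_scope.

(** If [a^2 + 1 = 2 z^2] and [c = z^2 - 1], then [2 a^2 + 2 = (2 z)^2],
    [a^2 + c^2 = (z^2)^2] and [2 a^2 + c^2 + 2 = (z^2 + 1)^2].  Hence if
    [2 z^2 alpha] and [c^2 alpha] both lie less than 1/6 below integers [k] and
    [m], and [alpha < 2/3], then [k], [k], [m] is a triple: each of its
    sums exceeds [alpha] times the corresponding square by an amount in (0, 1).

    That almost every [alpha] meets both conditions for infinitely many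
    solutions [(a, z)] of the Pell equation follows from Lebesgue's density
    theorem, applied twice: near any point the first condition fills a fixed
    proportion of an interval of length about [z^-2], and near a point
    satisfying the first condition with some margin, both conditions fill a
    fixed proportion of an interval of the much smaller length [z^-4]. *)

(** At almost every [x] outside [G] the density of [G] is 0, whereas an interval of length [c * r]
    inside [G] takes up the proportion [c / 2] of [ball x r], for arbitrarily small [r]. *)
Lemma fat_near_ae {R : realType} {G : set R} {c : R} : measurable G -> 0 < c ->
  {ae @lebesgue_measure R, forall x : R,
     (forall e, 0 < e -> exists r p : R,
        0 < r < e /\ `]p, (p + c * r)%R[ `<=` G `&` ball x r) -> G x}.
Proof.
move=> mG c0; have := lebesgue_density mG.
apply: filter_app; first exact: (ae_filter_ringOfSetsType lebesgue_measure).
apply: aeW => /= x dens fat; apply: contrapT => nGx.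
move: dens; rewrite indicE memNset// => dens.
have c2 : (0%:E < (c / 2)%:E :> \bar R)%E by rewrite lte_fin; lra.
have [e /= e0 small] := dens _ (open_ereal_lt' c2).
have [r [p [/andP[r0 re] sub]]] := fat e e0.
have /small/(_ r0) : ball (0 : R) e r by rewrite /ball/= sub0r normrN gtr0_norm.
rewrite ltNge => /negP; apply.
have r2 : (r *+ 2 != 0)%R by rewrite mulrn_eq0/= gt_eqF.
rewrite lebesgue_measure_ball ?(ltW r0)// inver (negbTE r2).
have -> : (c / 2)%:E = ((c * r)%:E * ((r *+ 2)^-1)%:E)%E.
  by rewrite -EFinM; congr EFin; rewrite -mulr_natr; field; rewrite gt_eqF.
apply: lee_wpmul2r; first by rewrite lee_fin invr_ge0 mulrn_wge0 ?ltW.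
have cr : p < p + c * r by rewrite ltrDl mulr_gt0.
have -> : (c * r)%:E = lebesgue_measure (`]p, (p + c * r)%R[%classic : set R).
  by rewrite lebesgue_measure_itv/= lte_fin cr -EFinB; congr EFin; ring.
apply: le_measure; rewrite ?inE//; apply: measurableI => //.
exact: measurable_ball.
Qed.

Definition below_int {R : realType} (P x y : R) : set R :=
  [set u | exists k : int, x < k%:~R - u * P < y].

Lemma open_below_int {R : realType} (P x y : R) : open (below_int P x y).
Proof.
rewrite (_ : below_int P x y =
  \bigcup_(k : int) (fun u : R => k%:~R - u * P) @^-1` `]x, y[); last first.
  apply/seteqP; split=> [u [k hk]|u [k _ hk]]; exists k => //=.
apply: bigcup_open => k _; apply: open_comp; last exact: itv_open.
move=> u _; apply: cvgB; first exact: cvg_cst.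
by apply: cvgM; [exact: cvg_id|exact: cvg_cst].
Qed.

(** For the integer [k] with [k - 1 <= u * P < k], the points [z] with [z * P] in []k - y, k - x[]
    form the interval; both products lie in [[k - 1, k[], so [z] is within [P^-1] of [u]. *)
Lemma below_int_fat {R : realType} {P x y : R} (u : R) : 0 < P -> 0 <= x -> y <= 1 ->
  exists p, `]p, (p + (y - x) * P^-1)%R[ `<=` below_int P x y `&` ball u P^-1.
Proof.
move=> P0 x0 y1; pose k := Num.floor (u * P) + 1.
have /andP[k1 k2] := floor_itv (u * P).
rewrite -/k in k2.
have k1' : k%:~R - 1 <= u * P by rewrite /k intrD addrK.
exists ((k%:~R - y) / P) => z /=; rewrite in_itv/= -mulrDl => /andP[].
rewrite ltr_pdivrMr// ltr_pdivlMr// => z1 z2; split.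
  by exists k; apply/andP; split; lra.
rewrite /ball/= -(ltr_pM2r P0) mulVf ?gt_eqF//.
by rewrite -{1}(gtr0_norm P0) -normrM mulrBl ltr_norml; apply/andP; split; lra.
Qed.

Lemma ball_below_int {R : realType} {P x y d u r : R} : 0 < P -> r * P <= d ->
  below_int P (x + d) (y - d) u -> ball u r `<=` below_int P x y.
Proof.
move=> P0 rd [k /andP[k1 k2]] z; rewrite /ball/= -(ltr_pM2r P0).
rewrite -{1}(gtr0_norm P0) -normrM mulrBl ltr_norml => /andP[z1 z2].
by exists k; apply/andP; split; lra.
Qed.

Lemma ceil_squareP {R : realType} {u : R} (n : nat) {j : int} : (0 < n)%N ->
  0 <= j%:~R - u * n%:R ^+ 2 < 1 -> ceil_squares u j.
Proof.
move=> n0 /andP[j1 j2]; exists n => //.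
by apply: ceil_def; apply/andP; split; rewrite ?intrB; lra.
Qed.

(* The recursion is multiplication of [a + z sqrt 2] by [3 + 2 sqrt 2]. *)
Fixpoint pell (n : nat) : nat * nat :=
  if n is n'.+1 then let: (a, z) := pell n' in (3 * a + 4 * z, 2 * a + 3 * z)%N
  else (7, 5)%N.

Lemma pellP (n : nat) : ((pell n).1 ^ 2 + 1 = 2 * (pell n).2 ^ 2)%N.
Proof. by elim: n => //= n; case: (pell n) => a z /=; lia. Qed.

(** This linear bound suffices to send both [2 z^2] and [(z^2 - 1)^2 / (2 z^2)] to infinity. *)
Lemma pell_gt (n : nat) : (n + 4 < (pell n).2)%N.
Proof. by elim: n => //= n; case: (pell n) => a z /=; lia. Qed.

(** Around every point, the union over [n >= N] fills a fixed proportion of arbitrarily small balls,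
    hence has full measure; then intersect over the countably many [N]. *)
Lemma below_int_io_ae {R : realType} {P : R^nat} {x y : R} :
  (forall n, 0 < P n) -> P n @[n --> \oo] --> +oo -> 0 <= x -> x < y -> y <= 1 ->
  {ae @lebesgue_measure R, forall u : R,
     forall N, exists2 n, (N <= n)%N & below_int (P n) x y u}.
Proof.
move=> P0 Poo x0 xy y1.
apply/ae_foralln => N.
pose G := \bigcup_(n in [set n | (N <= n)%N]) below_int (P n) x y.
have mG : measurable G.
  by apply: open_measurable; apply: bigcup_open => n _; exact: open_below_int.
have yx : 0 < y - x by rewrite subr_gt0.
have := fat_near_ae mG yx.
apply: filter_app; first exact: (ae_filter_ringOfSetsType lebesgue_measure).
apply: aeW => u /= fat.
have [e e0|n Nn un] := fat; last by exists n.
have [n [nN Pe]] : exists n, (N <= n)%N /\ e^-1 < P n.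
  near \oo => n; exists n; split; near: n; first exact: nbhs_infty_ge.
  by move/cvgryPgt: Poo => /(_ e^-1).
have [p hp] := below_int_fat u (P0 n) x0 y1.
exists (P n)^-1, p; split.
  by rewrite invr_gt0 P0/= invf_plt ?posrE ?P0.
by move=> z /hp[zP zu]; split=> //; exists n.
Unshelve. all: by end_near. Qed.

Lemma below_int2_io_ae {R : realType} {P Q : R^nat} {y : R} :
  (forall n, 0 < P n) -> P n @[n --> \oo] --> +oo ->
  (forall n, 0 < Q n) -> (Q n / P n) @[n --> \oo] --> +oo ->
  0 < y <= 1 ->
  {ae @lebesgue_measure R, forall u : R, forall N,
     exists2 n, (N <= n)%N & below_int (P n) 0 y u /\ below_int (Q n) 0 y u}.
Proof.
move=> P0 Poo Q0 QPoo /andP[y0 y1].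
apply/ae_foralln => N.
pose G := \bigcup_(n in [set n | (N <= n)%N])
  (below_int (P n) 0 y `&` below_int (Q n) 0 y).
have mG : measurable G.
  apply: open_measurable; apply: bigcup_open => n _.
  by apply: openI; exact: open_below_int.
have [d0 dy d1] : [/\ 0 <= y / 4, y / 4 < y - y / 4 & y - y / 4 <= 1].
  by split; lra.
have := fat_near_ae mG y0.
apply: filter_app; first exact: (ae_filter_ringOfSetsType lebesgue_measure).
have := below_int_io_ae P0 Poo d0 dy d1.
apply: filter_app; first exact: (ae_filter_ringOfSetsType lebesgue_measure).
apply: aeW => u /= io fat.
have [e e0|n Nn un] := fat; last by exists n.
(* The bounds ensure [(Q n)^-1 < e] and [P n / Q n <= y / 4]: on the ball of radius [(Q n)^-1] the
   margin [y / 4] preserves the condition for [P n]. *)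
have [N' _ big] : \forall n \near \oo, e^-1 < P n /\ 4 / y <= Q n / P n /\ 1 <= Q n / P n.
  near=> n; split; last split; near: n.
  - by move/cvgryPgt: Poo => /(_ e^-1).
  - by move/cvgryPge: QPoo => /(_ (4 / y)).
  - by move/cvgryPge: QPoo => /(_ 1).
have [n Nn un] := io (maxn N N').
move: Nn; rewrite geq_max => /andP[Nn /big[Pe]].
rewrite !ler_pdivlMr// mul1r => -[QyP QP].
have [p hp] := below_int_fat u (Q0 n) (lexx 0) y1.
exists (Q n)^-1, p; split.
  by rewrite invr_gt0 Q0/= invf_plt ?posrE// (lt_le_trans Pe).
move=> z; rewrite -[y in _ + y * _]subr0 => /hp[zQ zu]; split=> //.
exists n => //; split=> //.
apply: (ball_below_int (d := y / 4) (P0 n) _ _ _ zu); last by rewrite add0r.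
rewrite mulrC ler_pdivrMr//; move: QyP; rewrite mulrAC ler_pdivrMr//; lra.
Unshelve. all: by end_near. Qed.

(** The final bound on [k] makes the triples found for growing [z] infinitely many. *)
Lemma ceil_triples_pell {R : realType} {u : R} {a z : nat} :
  0 < u < 2 / 3 -> (1 < z)%N -> (a ^ 2 + 1 = 2 * z ^ 2)%N ->
  below_int (2 * z%:R ^+ 2) 0 6^-1 u ->
  below_int ((z%:R ^+ 2 - 1) ^+ 2) 0 6^-1 u ->
  exists k m : nat, ceil_triples u (k, k, m) /\ u * (2 * z%:R ^+ 2) < k%:R.
Proof.
move=> /andP[u0 u1] z1 az [k /andP[k0 k1]] [m /andP[m0 m1]].
have z2 : 2 <= z%:R :> R by rewrite ler_nat.
have {}az : a%:R ^+ 2 = 2 * z%:R ^+ 2 - 1 :> R.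
  by apply/eqP; rewrite eq_sym subr_eq -natrX -natrX natr1 -natrM -az addn1.
have zn : (0 < z ^ 2 - 1)%N by rewrite subn_gt0 -{1}(exp1n 2) ltn_sqr.
have zE : (z ^ 2 - 1)%:R = z%:R ^+ 2 - 1 :> R.
  by rewrite natrB ?natrX// expn_gt0 ltnW.
have uz : 0 < u * (2 * z%:R ^+ 2).
  by rewrite mulr_gt0// mulr_gt0// exprn_gt0// (lt_le_trans _ z2).
have um : 0 <= u * (z%:R ^+ 2 - 1) ^+ 2 by apply: mulr_ge0 (ltW u0) (sqr_ge0 _).
have kp : (0 < k)%R by rewrite -(ltr0z R); lra.
have mp : (0 < m)%R by rewrite -(ltr0z R); lra.
case: k kp k0 k1 => // k kp; rewrite -pmulrn => k0 k1.
case: m mp m0 m1 => // m mp; rewrite -pmulrn => m0 m1.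
exists k, m; split; last by lra.
(* Since [(z^2 - 1)^2 - 2 z^2 = z^2 (z^2 - 4) + 1 > 0], the difference [k - m] is less than 1/6. *)
have km : (k <= m)%N.
  rewrite -ltnS -(ltr_nat R) -natr1.
  have z4 : 4 <= z%:R ^+ 2 :> R by nra.
  have : 0 <= u * (z%:R ^+ 2 * (z%:R ^+ 2 - 4) + 2).
    by apply: mulr_ge0 (ltW u0) _; nra.
  nra.
have Sa : k%:R - u * a%:R ^+ 2 = k%:R - u * (2 * z%:R ^+ 2) + u by rewrite az; ring.
have a0 : (0 < a)%N.
  by rewrite lt0n; apply: contraTneq z2 => a0; rewrite -ltNge; move: az; rewrite a0; nra.
have Sk : ceil_squares u k%:Z.
  by apply: (ceil_squareP a) => //; rewrite -pmulrn; apply/andP; split; nra.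
have Sm : ceil_squares u m%:Z.
  by apply: (ceil_squareP (z ^ 2 - 1)) => //; rewrite -pmulrn zE; apply/andP; split; lra.
(* This is the tight case: [2 z^2 + (z^2 - 1)^2 = z^4 + 1], so the excess over [u * z^4] is below
   [1/6 + 1/6 + u < 1], which uses [u < 2/3]. *)
have Skm : ceil_squares u (k + m)%N%:Z.
  apply: (ceil_squareP (z ^ 2)); first by rewrite expn_gt0 ltnW.
  by rewrite -pmulrn natrD natrX; apply/andP; split; nra.
split; first by split.
split; first by split.
split.
  split=> //; last by rewrite addnC.
  apply: (ceil_squareP (2 * z)); first by rewrite muln_gt0 (ltnW z1).
  by rewrite -pmulrn natrD natrM; apply/andP; split; nra.
apply: (ceil_squareP (z ^ 2 + 1)); first by rewrite addn1.
by rewrite -pmulrn !natrD natrX; apply/andP; split; nra.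
Qed.

Theorem theoremA3 (R : realType) :
  {ae @lebesgue_measure R, forall alpha : R,
     0 < alpha < 2 / 3 -> infinite_set (ceil_triples alpha)}.
Proof.
pose z n : R := (pell n).2%:R.
have zn n : n%:R + 5 <= z n by rewrite -natrD ler_nat addnS pell_gt.
have z5 n : 5 <= z n by apply: le_trans (zn n); rewrite lerDr.
have P0 n : 0 < 2 * z n ^+ 2 by have := z5 n; nra.
have Q0 n : 0 < (z n ^+ 2 - 1) ^+ 2.
  by rewrite exprn_gt0// subr_gt0; have := z5 n; nra.
have Poo : 2 * z n ^+ 2 @[n --> \oo] --> +oo.
  apply/cvgryPge => M; near=> n.
  have : M <= n%:R by near: n; exact: nbhs_infty_ger.
  have := zn n; have : 5 * z n <= z n ^+ 2 by have := z5 n; nra.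
  have := z5 n; lra.
have QPoo : (z n ^+ 2 - 1) ^+ 2 / (2 * z n ^+ 2) @[n --> \oo] --> +oo.
  apply/cvgryPge => M; near=> n.
  have : M <= n%:R by near: n; exact: nbhs_infty_ger.
  rewrite ler_pdivlMr// => Mn.
  (* As [M <= z], it remains to see [2 z^3 <= (z^2 - 1)^2], which follows from [5 z^3 <= z^4] and
     [z^2 <= z^3]. *)
  have Mz : M <= z n by have := zn n; lra.
  have : M * z n ^+ 2 <= z n * z n ^+ 2 by rewrite ler_wpM2r ?sqr_ge0.
  have : 5 * z n ^+ 3 <= z n ^+ 4.
    by rewrite (exprS _ 3) ler_wpM2r// exprn_ge0// (le_trans _ (z5 n)).
  have : 0 <= z n ^+ 2 * (z n - 1).
    by rewrite mulr_ge0 ?sqr_ge0// subr_ge0 (le_trans _ (z5 n))// ler1n.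
  nra.
have y01 : 0 < (6^-1 : R) <= 1 by apply/andP; split; lra.
have := below_int2_io_ae P0 Poo Q0 QPoo y01.
apply: filter_app; first exact: (ae_filter_ringOfSetsType lebesgue_measure).
apply: aeW => u /= io u01 /finite_seqP[s sE].
have /andP[u0 _] := u01.
(* [B] bounds the first entries of all triples in the supposed finite list; a solution with
   [u * (2 z^2) >= B] yields a triple with [k > B]. *)
pose B := (\sum_(t <- s) t.1.1)%N.
have [N _ big] : \forall n \near \oo, B%:R / u <= 2 * z n ^+ 2.
  by move/cvgryPge: Poo => /(_ (B%:R / u)).
have [n /big Bn [uP uQ]] := io N.
have [|k [m [T kn]]] := ceil_triples_pell u01 _ (pellP n) uP uQ.
  by rewrite (leq_trans _ (pell_gt n))// addn4.
move: T; rewrite sE /= => ks.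
have : (k <= B)%N by rewrite /B (big_rem _ ks) /= leq_addr.
rewrite leqNgt -(ltr_nat R) (le_lt_trans _ kn)//.
by move: Bn; rewrite ler_pdivrMr// mulrC.
Unshelve. all: by end_near. Qed.
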